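(* Let $X$ be a metric space. If the major coarse dimension $\dim^{COA}_{RSE}(X)$ is finite, then it equals the large scale dimension of $X$: $\dim^{COA}_{RSE}(X)=\dim^{large}_{scale}(X)$.
   Context: Let $(X,d)$ be a metric space. For points, $x_k\to\infty$ means $d(x_k,x_0)\to\infty$ for some (hence every) $x_0\in X$. A function $f:X\to[0,\infty]$ is coarsely proper if $f(x_k)\to\infty$ whenever $x_k\to\infty$. Families of subsets of $X$ need not cover $X$. For a family $\mathcal U$ of subsets of $X$, $L_{\mathcal U}(x)=\sup_{U\in\mathcal U}\mathrm{dist}(x,X\setminus U)\in[0,\infty]$, with $\mathrm{dist}(x,\emptyset)=\infty$ and the supremum over the empty family equal to $0$. The Lebesgue number of $\mathcal U$ is $L(\mathcal U,X)=\inf_{x\in X}L_{\mathcal U}(x)$. The family $\mathcal U$ is coarse if $L_{\mathcal U}$ is coarsely proper. The multiplicity of $\mathcal U$ is the supremum over $x\in X$ of the number of elements of $\mathcal U$ containing $x$. $\mathcal V$ refines $\mathcal U$ if each element of $\mathcal V$ is contained in some element of $\mathcal U$; a coarse refinement is a refinement that is a coarse family. For $A\subset X$ and a family $\mathcal U$ in $X$, $L^n(\mathcal U,A)$ is the supremum of all $t\in[0,\infty]$ such that the family $\mathcal U|_A=\{U\cap A\}_{U\in\mathcal U}$ in the metric space $A$ has a refinement (by subsets of $A$) of multiplicity at most $n+1$ and Lebesgue number (computed in the metric space $A$) at least $t$. Major coarse dimension $\dim^{COA}_{RSE}(X)$: the smallest integer $n\ge-1$ such that every (not necessarily finite) coarse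 family in $X$ has a coarse refinement of multiplicity at most $n+1$. Large scale dimension $\dim^{large}_{scale}(X)$: the smallest integer $n\ge-1$ such that for every finite coarse family $\mathcal U$ in $X$ the function $A\mapsto L^n(\mathcal U,A)$ is coarsely proper on nonempty bounded subsets of $X$, i.e. $L^n(\mathcal U,A_k)\to\infty$ whenever $A_k$ are nonempty bounded subsets with $\mathrm{dist}(x_0,A_k)\to\infty$. In particular it is $-1$ if $X$ is bounded. Each dimension is $\infty$ if no such integer exists. *)

(* Defs.v *)
From mathcomp Require Import all_boot all_order all_algebra.
From mathcomp Require Import all_classical all_reals all_analysis.

Set Implicit Arguments.
Unset Strict Implicit.
Unset Printing Implicit Defensive.

Import Order.TTheory GRing.Theory Num.Theory.
Import numFieldNormedType.Exports.

Local Open Scope classical_set_scope.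
Local Open Scope ring_scope.
Local Open Scope ereal_scope.

Section CoarseDimensions.
Context {R : realType} {X : metricType R}.
Implicit Types (x : X) (A B : set X) (U V : set (set X)).

Definition dist x B : \bar R := ereal_inf [set (mdist x y)%:E | y in B].

Definition bounded A : Prop :=
  exists r : R, forall x y, A x -> A y -> (mdist x y <= r)%R.

(* A metric subspace A of X is represented by the set A itself: the complement
   of W in A is A `\` W, and points range over A.  Adjoining 0 makes the
   supremum over the empty family equal to 0. *)
Definition Lebesgue_fun A U x : \bar R :=
  ereal_sup (0 |` [set dist x (A `\` W) | W in U]).

Definition Lebesgue_number U A : \bar R :=
  ereal_inf [set Lebesgue_fun A U x | x in A].

Definition multiplicity U : \bar R :=
  ereal_sup (0 |` range (fun x => counting [set W | U W /\ W x])).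

Definition refines V U : Prop :=
  forall W, V W -> exists2 W', U W' & W `<=` W'.

Definition tends_to_infinity (u : nat -> X) : Prop :=
  exists x0, (mdist (u k) x0)%:E @[k --> \oo] --> +oo.

Definition coarsely_proper (f : X -> \bar R) : Prop :=
  forall u : nat -> X, tends_to_infinity u -> f (u k) @[k --> \oo] --> +oo.

Definition coarse U : Prop := coarsely_proper (Lebesgue_fun [set: X] U).

Definition restrict_family U A : set (set X) := [set W `&` A | W in U].

(* A refinement of [restrict_family U A] automatically consists of subsets of A. *)
Definition Ln (n : int) U A : \bar R :=
  ereal_sup [set t | 0 <= t /\ exists V,
    [/\ refines V (restrict_family U A),
        multiplicity V <= ((n + 1)%:~R)%:E
      & t <= Lebesgue_number V A]].

Definition sets_tend_to_infinity (A : nat -> set X) : Prop :=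
  exists x0, dist x0 (A k) @[k --> \oo] --> +oo.

Definition coarsely_proper_on_bounded (F : set X -> \bar R) : Prop :=
  forall A : nat -> set X,
    (forall k, A k !=set0 /\ bounded (A k)) ->
    sets_tend_to_infinity A -> F (A k) @[k --> \oo] --> +oo.

End CoarseDimensions.

Definition smallest_dim (P : int -> Prop) : \bar int :=
  xget +oo [set d : \bar int | exists n : int,
    [/\ d = n%:E, (-1 <= n)%R, P n
      & forall m : int, (-1 <= m)%R -> P m -> (n <= m)%R]].

Definition major_coarse_dim {R : realType} (X : metricType R) : \bar int :=
  smallest_dim (fun n => forall U : set (set X), coarse U ->
    exists V, [/\ refines V U, coarse V
                & multiplicity V <= ((n + 1)%:~R)%:E]).

Definition large_scale_dim {R : realType} (X : metricType R) : \bar int :=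
  smallest_dim (fun n => forall U : set (set X), finite_set U -> coarse U ->
    coarsely_proper_on_bounded (Ln n U)).

(* Main.v *)
Require Import Defs.
From mathcomp Require Import all_boot all_order all_algebra.
From mathcomp Require Import all_classical all_reals all_analysis.
From mathcomp Require Import lra zify.

Set Implicit Arguments.
Unset Strict Implicit.
Unset Printing Implicit Defensive.

Import Order.TTheory GRing.Theory Num.Theory.
Local Open Scope classical_set_scope.
Local Open Scope card_scope.
Local Open Scope ring_scope.

(** Write [M] for [n + 1] and fix a base point [x0].  Both dimensions are read
    scale by scale: a family is coarse when, for every [s], all far away
    [s]-balls lie in members ([coarseP]), and [Ln n U] is coarsely proper when,
    for every [s], the restriction of [U] to any bounded set far from [x0] has
    a refinement of multiplicity at most [M] whose members contain the
    [s]-balls of that set ([far_refinable], [Ln_properP]).  A global coarse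
    refinement restricts to every bounded set, so the large scale dimension
    never exceeds the major coarse dimension ([coarse_refinement_far]).

    For the converse suppose that every finite coarse family is far refinable
    with multiplicity [M], and that every coarse family has a coarse refinement
    of some finite multiplicity [K]; the latter is all that finiteness of the
    major coarse dimension provides.

    The first step extends far refinability from finite to arbitrary coarse
    families ([coarse_far_refinable]).  Let [V] be a coarse refinement of
    multiplicity at most [K], and let [t x] be a slowly growing scale.  For
    each [i] from 1 to [K + 1] consider the set of points where no member of
    [V] has depth between [2 i t] and [(2 i + 1) t].  By the pigeonhole
    principle every point far out lies, with a large ball, in one of these
    [K + 1] sets, so they form a finite coarse family.  On the [i]-th set the
    members of depth at least [2 i t] do not change between nearby points;
    cutting along them turns a refinement of the finite family into a
    refinement of [V] and costs neither multiplicity nor Lebesgue number.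

    The second step glues refinements of annuli ([far_refinable_glue]).  The
    space is sliced into annuli by a slowly varying level function.  Around
    each even annulus take a refinement of [U] with a huge Lebesgue number, on
    a neighbourhood that includes both adjacent odd annuli; on each odd annulus
    take a refinement by sets that are small compared with that Lebesgue
    number.  Restrict the first ones to the even annuli, and let each small set
    close to an even annulus be absorbed by a single member there that
    contains it together with a neighbourhood.  Since every small set is
    absorbed once, the multiplicity does not grow, and since the absorbing
    member contains it, the result still refines [U]. *)

(** * Coarse families and Lebesgue numbers, scale by scale *)

Section Balls.
Context {R : realType} {X : metricType R}.
Implicit Types (x y z : X) (A B W : set X) (U V : set (set X)) (s t : R).

(** [Lebesgue_fun A U x] is at least [s], up to an arbitrarily small loss; in
    this form the empty family and infinite distances need no special care. *)
Definition contains_ball A U s x : Prop :=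
  exists2 W, U W & forall y, A y -> mdist x y < s -> W y.

Definition mult_le (M : nat) V : Prop :=
  forall x, [set W | V W /\ W x] #<= `I_M.

Lemma contains_ball_le A U s t x :
  s <= t -> contains_ball A U t x -> contains_ball A U s x.
Proof.
move=> st [W UW sW]; exists W => // y Ay xy.
by apply: sW => //; exact: lt_le_trans st.
Qed.

Lemma Lebesgue_fun_ge A U s x :
  contains_ball A U s x -> (s%:E <= Lebesgue_fun A U x)%E.
Proof.
move=> [W UW sW]; apply: (@le_trans _ _ (dist x (A `\` W))).
  apply: le_ereal_inf_tmp => _ [y [Ay nWy] <-]; rewrite lee_fin leNgt.
  by apply/negP => xy; exact/nWy/sW.
by apply: ereal_sup_ubound; right; exists W.
Qed.

Lemma contains_ball_Lebesgue_fun A U s x : 0 <= s ->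
  (s%:E < Lebesgue_fun A U x)%E -> contains_ball A U s x.
Proof.
move=> s0 /ereal_sup_gt[_ [->|[W UW <-]]]; first by rewrite lte_fin ltNge s0.
move=> sW; exists W => // y Ay xy; apply: contrapT => nWy.
have : (dist x (A `\` W) <= (mdist x y)%:E)%E.
  by apply: ereal_inf_lbound; exists y.
by move=> /(lt_le_trans sW); rewrite lte_fin ltNge (ltW xy).
Qed.

Lemma multiplicityP (M : nat) V :
  (multiplicity V <= M%:R%:E)%E <-> mult_le M V.
Proof.
split=> [VM x|VM].
  have : (counting [set W | V W /\ W x] <= M%:R%:E :> \bar R)%E.
    by apply: le_trans VM; apply: ereal_sup_ubound; right; exists x.
  rewrite /counting; case: ifPn => [/asboolP fV|//].
  rewrite lee_fin ler_nat => leM.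
  have [n Vn] := fV; rewrite (card_le_eql Vn) card_le_II.
  by rewrite -(card_fset_set Vn).
apply: ge_ereal_sup => _ [->|[x _ <-]]; first by rewrite lee_fin.
have fV : finite_set [set W | V W /\ W x].
  exact: card_le_finite (VM x) (finite_II M).
rewrite /counting asboolT// lee_fin ler_nat.
exact: geq_card_fset_set.
Qed.

Lemma mult_le_set0 (M : nat) : mult_le M (set0 : set (set X)).
Proof.
move=> x; rewrite (_ : [set _ | _] = set0); first exact: card_ge0.
by apply/seteqP; split=> // W [].
Qed.

(** Used to bound the multiplicity of a modified family at a point: each new
    member through the point is the image of an old member through it. *)
Lemma card_members_le (M : nat) (S T : set (set X)) (f : set X -> set X) :
  T `<=` f @` S -> S #<= `I_M -> T #<= `I_M.
Proof.
move=> /subset_card_le TfS SM; apply: card_le_trans SM.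
exact: card_le_trans (card_image_le f S).
Qed.

(** If the condition failed at scale [s], points violating it at distance at
    least [k] would form a sequence tending to infinity along which the
    Lebesgue function stays bounded. *)
Lemma coarseP (x0 : X) U : coarse U <->
  forall s, exists r, forall x, r <= mdist x x0 -> contains_ball [set: X] U s x.
Proof.
split=> [cU s|cU u [x1 ux1]].
  apply: contrapT => /forallNP nr.
  have {}nr k : exists x, k%:R <= mdist x x0 /\ ~ contains_ball setT U s x.
    have /existsNP[x /not_implyP ?] := nr k%:R; by exists x.
  have [u uP] := choice nr.
  have utoo : tends_to_infinity u.
    exists x0; apply/cvgeyPge => A.
    near=> k; rewrite lee_fin; apply: le_trans (uP k).1.
    by near: k; exact: nbhs_infty_ger.
  have /cvgey_gt/(_ (Num.max s 0)) := cU u utoo.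
  move=> [k _ /(_ k (leqnn k))]/= /contains_ball_Lebesgue_fun.
  rewrite le_max lexx orbT => /(_ isT).
  move=> /(@contains_ball_le _ _ s); rewrite le_max lexx => /(_ isT).
  exact: (uP k).2.
apply/cvgeyPge => s; have [r rP] := cU s.
have /cvgeyPge/(_ (r + mdist x0 x1)) := ux1.
apply: filterS => k; rewrite lee_fin => uk; apply/Lebesgue_fun_ge/rP.
have := metric_triangle (u k) x0 x1; lra.
Unshelve. all: by end_near. Qed.

End Balls.

Definition refinable_on {R : realType} {X : metricType R}
    (M : nat) (U : set (set X)) (A : set X) (s : R) : Prop :=
  exists V, [/\ refines V (restrict_family U A), mult_le M V
    & forall x, A x -> contains_ball A V s x].

Section Dimensions.
Context {R : realType} {X : metricType R}.
Implicit Types (x y z : X) (A B W : set X) (U V : set (set X)) (s t : R).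

Lemma refines_restrict V U A : refines V (restrict_family U A) <->
  forall W, V W -> W `<=` A /\ exists2 W', U W' & W `<=` W'.
Proof.
split=> VU W VW.
  have [_ [W' UW' <-] sub] := VU W VW; split; first by move=> y /sub[].
  by exists W' => // y /sub[].
have [WA [W' UW' sub]] := VU W VW; exists (W' `&` A); first by exists W'.
by move=> y Wy; split; [exact: sub|exact: WA].
Qed.

Definition far_refinable (M : nat) U x0 := forall s, exists r, forall A,
  bounded A -> (forall x, A x -> r <= mdist x x0) -> refinable_on M U A s.

(** As for [coarseP], choosing for each [k] a bad bounded set at distance at
    least [k] gives a sequence contradicting coarse properness; such a set is
    nonempty because the empty family refines everything on the empty set. *)
Lemma Ln_properP (x0 : X) (M : nat) (n : int) U : n + 1 = M%:Z ->
  coarsely_proper_on_bounded (Ln n U) <-> far_refinable M U x0.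
Proof.
move=> nM; have nME : ((n + 1)%:~R)%:E = M%:R%:E :> \bar R by rewrite nM.
split=> [pL s|pL A A0 [x1 Ax1]].
  apply: contrapT => /forallNP nr.
  have {}nr k : exists A, [/\ bounded A, forall x, A x -> k%:R <= mdist x x0
      & ~ refinable_on M U A s].
    have /existsNP[A /not_implyP[bA /not_implyP[? ?]]] := nr k%:R.
    by exists A.
  have [A AP] := choice nr.
  have A0 k : A k !=set0 /\ bounded (A k).
    split; last by have [] := AP k.
    apply/set0P/eqP => Ak0; have [_ _] := AP k; apply.
    exists set0; split=> //; last by rewrite Ak0.
    exact: mult_le_set0.
  have Ay : sets_tend_to_infinity A.
    exists x0; apply/cvgeyPge => c; near=> k.
    apply: le_ereal_inf_tmp => _ [y Aky <-]; rewrite lee_fin metric_sym.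
    have [_ kA _] := AP k; apply: le_trans (kA _ Aky).
    by near: k; exact: nbhs_infty_ger.
  have /cvgey_gt/(_ (Num.max s 0)) := pL A A0 Ay.
  move=> [k _ /(_ k (leqnn k))]/= /ereal_sup_gt[t [t0 [V [rV mV tV]]] st].
  have [_ _] := AP k; apply; exists V; split=> //.
    by apply/multiplicityP; rewrite -nME.
  move=> x Akx; apply: (@contains_ball_le _ _ _ _ _ (Num.max s 0)).
    by rewrite le_max lexx.
  apply: contains_ball_Lebesgue_fun; first by rewrite le_max lexx orbT.
  apply: (lt_le_trans st); apply: (le_trans tV).
  by apply: ereal_inf_lbound; exists x.
apply/cvgeyPge => s; have [r rP] := pL (Num.max s 0).
have /cvgeyPge/(_ (r + mdist x1 x0)) := Ax1.
apply: filterS => k Ak.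
have [V [rV mV bV]] : refinable_on M U (A k) (Num.max s 0).
  apply: rP => [|x Akx]; first by have [] := A0 k.
  have : (r + mdist x1 x0 <= mdist x1 x).
    rewrite -lee_fin; apply: (le_trans Ak).
    by apply: ereal_inf_lbound; exists x.
  have := metric_triangle x1 x0 x; rewrite (metric_sym x0 x); lra.
apply: (@le_trans _ _ (Num.max s 0)%:E).
  by rewrite lee_fin le_max lexx.
apply: ereal_sup_ubound; split.
  by rewrite lee_fin le_max lexx orbT.
exists V; split=> //; first by rewrite nME; exact/multiplicityP.
apply: le_ereal_inf_tmp => _ [x Akx <-]; apply/Lebesgue_fun_ge; exact: bV.
Unshelve. all: by end_near. Qed.

End Dimensions.

(** * Slow level functions *)

Section Levels.
Context {R : realType}.

(** The gaps between radii grow, so that a ball around a point of level [m],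
    of radius proportional to [m], stays in the levels [m - 1], [m], [m + 1]. *)
Fixpoint level_radius (rho : nat -> R) (m : nat) : R :=
  if m is m'.+1 then
    Num.max (level_radius rho m') (rho m'.+1) + 4 * m'.+2%:R
  else 0.

Lemma level_radiusS rho m :
  level_radius rho m + 4 * m.+2%:R <= level_radius rho m.+1.
Proof. by rewrite /= lerD2r le_max lexx. Qed.

Lemma level_radius_homo rho m n :
  (m <= n)%N -> level_radius rho m <= level_radius rho n.
Proof.
elim: n => [|n IHn]; first by rewrite leqn0 => /eqP ->.
rewrite leq_eqVlt => /orP[/eqP->//|]; rewrite ltnS => /IHn /le_trans; apply.
apply: le_trans (level_radiusS rho n); rewrite lerDl mulr_ge0//.
Qed.

Lemma level_radius_ge_nat rho m : m%:R <= level_radius rho m.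
Proof.
elim: m => // m IHm; apply: le_trans (level_radiusS rho m).
have : 0 <= m%:R :> R by [].
by rewrite -[m.+2]addn2 -[m.+1]addn1 !natrD; lra.
Qed.

Context {X : metricType R}.

(** [lev] plays the part of an integer-valued, very slowly growing scale
    function: it changes by at most 1 on balls of radius [4 (lev x + 1)], and
    [rho] prescribes how far from [x0] a point must be to have a given level. *)
Record level_function (x0 : X) (rho : nat -> R) (lev : X -> nat) : Prop := {
  level_slow : forall x y, mdist x y < 4 * (lev x).+1%:R ->
    (lev y <= (lev x).+1)%N /\ (lev x <= (lev y).+1)%N;
  level_unbounded : forall m, exists r, forall x,
    r <= mdist x x0 -> (m <= lev x)%N;
  level_bounded : forall m, bounded [set x | (lev x <= m)%N];
  level_far : forall m x, (0 < m <= lev x)%N -> rho m <= mdist x x0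
}.

(** The level of [x] is the largest [m] whose radius is at most the distance
    from [x] to [x0]; it exists because the [m]-th radius is at least [m]. *)
Lemma exists_level_function x0 rho : exists lev, level_function x0 rho lev.
Proof.
set b := level_radius rho.
have levx (x : X) : exists n, forall m, (m <= n)%N = (b m <= mdist x x0).
  have bx0 : exists i, b i <= mdist x x0 by exists 0%N; exact: mdist_ge0.
  have bxle i : b i <= mdist x x0 -> (i <= Num.truncn (mdist x x0))%N.
    move=> /(le_trans (level_radius_ge_nat rho i)).
    by rewrite truncn_ge_nat// mdist_ge0.
  exists (ex_maxn bx0 bxle); case: ex_maxnP => n bn nmax m.
  apply/idP/idP => [mn|]; last exact: nmax.
  exact: le_trans (level_radius_homo rho mn) bn.
have [lev levP] := choice levx; exists lev; split.
- move=> x y; set m := lev x => xy.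
  have txy := metric_triangle x y x0; have tyx := metric_triangle y x x0.
  have yx := metric_sym y x.
  split.
    rewrite leqNgt levP -/b; apply/negP => by_.
    have := levP x m.+1; rewrite ltnn => /esym/negbT; rewrite -ltNge => bx.
    have := level_radiusS rho m.+1; rewrite -/b.
    move: xy by_ bx; lra.
  case Em : m => [//|k]; rewrite ltnS levP.
  have : b m <= mdist x x0 by rewrite -levP.
  move: (xy); rewrite Em => xy' bx; have := level_radiusS rho k; rewrite -/b.
  lra.
- by move=> m; exists (b m) => x; rewrite levP.
- move=> m; exists (b m.+1 + b m.+1) => x y /= xm ym.
  have lt_b z : (lev z <= m)%N -> mdist z x0 < b m.+1.
    by rewrite ltNge -levP -leqNgt.
  have := metric_triangle x x0 y; rewrite (metric_sym x0 y).
  by have := lt_b _ xm; have := lt_b _ ym; lra.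
- move=> [//|m] x; rewrite levP; apply: le_trans.
  by rewrite /b /=; apply: le_trans (_ : _ <= Num.max (b m) (rho m.+1)) _;
    rewrite ?le_max ?lexx ?orbT// lerDl mulr_ge0.
Qed.

End Levels.

(** * From finite to arbitrary coarse families *)

Section GapSets.
Context {R : realType} {X : metricType R}.
Implicit Types (x y z : X) (A W : set X) (U V : set (set X)).

(** The radii that matter are products of levels and indices, hence natural
    numbers, and comparing them is integer arithmetic. *)
Definition ball_in x (r : nat) W : Prop := forall y, mdist x y < r%:R -> W y.

Lemma ball_in_shift x y (r r' s : nat) W : mdist x y < s%:R ->
  (r' + s <= r)%N -> ball_in x r W -> ball_in y r' W.
Proof.
move=> xy rr Wx z yz; apply: Wx; apply: le_lt_trans (metric_triangle x y z) _.
by apply: lt_le_trans (ltrD xy yz) _; rewrite -natrD ler_nat addnC.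
Qed.

Lemma ball_in_center x (r : nat) W : (0 < r)%N -> ball_in x r W -> W x.
Proof. by move=> r0; apply; rewrite mdistxx ltr0n. Qed.

Definition deep_members V (lev : X -> nat) (i : nat) x : set (set X) :=
  [set W | V W /\ ball_in x (2 * i * lev x) W].

(** The points [x] at which no member of [V] has its depth in the interval from
    [2 i (lev x)] to [(2 i + 1) (lev x)].  Consecutive values of [i] give
    intervals a distance [lev x] apart, which leaves room for the variation of
    [lev]. *)
Definition gap_set V (lev : X -> nat) (i : nat) : set X :=
  [set x | forall W, V W ->
     ball_in x (2 * i * lev x) W -> ball_in x ((2 * i).+1 * lev x) W].

Lemma deep_members_sub V lev i (s : nat) y z :
  gap_set V lev i y -> mdist y z < s%:R ->
  (lev z <= (lev y).+1)%N -> (2 * i + s <= lev y)%N ->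
  deep_members V lev i y `<=` deep_members V lev i z.
Proof.
move=> gy yz lzy ly W [VW Wy]; split=> //.
by apply: (ball_in_shift yz) (gy W VW Wy); nia.
Qed.

(** A member deep at [y] is, by the gap, deeper than necessary by [lev y], and
    this surplus pays for the move to [z] and for the change of level. *)
Lemma deep_members_eq V lev i (s : nat) y z :
  gap_set V lev i y -> gap_set V lev i z -> mdist y z < s%:R ->
  (lev z <= (lev y).+1)%N -> (lev y <= (lev z).+1)%N ->
  (2 * i + s <= lev y)%N -> (2 * i + s <= lev z)%N ->
  deep_members V lev i y = deep_members V lev i z.
Proof.
move=> gy gz yz lzy lyz ly lz; apply/seteqP; split.
  exact: deep_members_sub gy yz lzy ly.
by apply: deep_members_sub gz _ lyz lz; rewrite metric_sym.
Qed.

(** Pigeonhole: if the [s]-ball at [x] left every gap set, then for each of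
    the [K + 1] indices some member of [V] would have a depth at [x] in the
    corresponding interval of depths.  The intervals are disjoint, even after
    being widened by [s] and by the variation of [lev], so these members are
    distinct; but only [K] members contain [x]. *)
Lemma ball_in_gap_set (K : nat) V lev (s : nat) x : mult_le K V ->
  (forall y, mdist x y < s%:R -> (lev y <= (lev x).+1)%N /\ (lev x <= (lev y).+1)%N) ->
  (2 * s + 4 * K + 10 <= lev x)%N ->
  exists2 i, (i < K.+1)%N & ball_in x s (gap_set V lev i.+1).
Proof.
move=> VK slow levx; apply: contrapT => /forall2NP ngap.
have {}ngap i : exists W, (i < K.+1)%N ->
    [/\ V W, ball_in x (2 * i.+1 * (lev x).-1 - s) W
      & ~ ball_in x ((2 * i.+1).+1 * (lev x).+1 + s) W].
  have [iK|/negP iK] := boolP (i < K.+1)%N; last by exists set0.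
  have [//|/existsNP[y /not_implyP[xy /existsNP[W]]]] := ngap i.
  move=> /not_implyP[VW /not_implyP[Wy nWy]].
  have [lyx lxy] := slow _ xy; have yx : mdist y x < s%:R by rewrite metric_sym.
  exists W => _; split=> //.
    by apply: (ball_in_shift yx) Wy; nia.
  by apply: contra_not nWy; apply: (ball_in_shift xy); nia.
have [W WP] := choice ngap.
have Winj : {in `I_K.+1 &, injective W}.
  move=> i j; rewrite !inE /=; wlog ij : i j / (i < j)%N.
    move=> wl iK jK Wij; case: (ltngtP i j) => // ij; first exact: wl.
    by apply/esym/wl.
  move=> iK jK Wij; have [_ _ nWi] := WP i iK; have [_ Wj _] := WP j jK.
  case: nWi; rewrite Wij => y xy; apply: Wj; apply: lt_le_trans xy _.
  by rewrite ler_nat; nia.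
suff : (K.+1 <= K)%N by rewrite ltnn.
rewrite -card_le_II; apply: card_le_trans (VK x).
rewrite -(card_le_eql (inj_card_eq Winj)); apply: subset_card_le.
move=> _ [i /= iK <-]; have [VWi Wi _] := WP i iK; split=> //.
by apply: (ball_in_center _ Wi); nia.
Qed.

Lemma contains_ballT_nat U (r : nat) x :
  contains_ball [set: X] U r%:R x <-> exists2 W, U W & ball_in x r W.
Proof.
split=> [[W UW Wx]|[W UW Wx]]; exists W => //; last by move=> y _; exact: Wx.
by move=> y; exact: Wx.
Qed.

Lemma coarse_gap_sets (x0 : X) K V rho lev : mult_le K V ->
  level_function x0 rho lev ->
  coarse [set gap_set V lev i.+1 | i in `I_K.+1].
Proof.
move=> VK levP; apply/(coarseP x0) => s; set s' := (Num.truncn s).+1.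
have [r rP] := level_unbounded levP (2 * s' + 4 * K + 10).
exists r => x /rP levx; apply: (@contains_ball_le _ _ _ _ _ s'%:R).
  exact/ltW/truncnS_gt.
have [y xy|i iK gi] := @ball_in_gap_set K V lev s' x VK _ levx.
  apply: (level_slow levP); apply: lt_le_trans xy _.
  by rewrite -natrM ler_nat; lia.
by apply/contains_ballT_nat; exists (gap_set V lev i.+1) => //; exists i.
Qed.

(** A bounded multiplicity [K] for coarse refinements reduces far refinability
    of infinite coarse families to that of the finite families of gap sets. *)
Lemma coarse_far_refinable (x0 : X) (M K : nat) :
  (forall U, coarse U -> exists V, [/\ refines V U, coarse V & mult_le K V]) ->
  (forall U, finite_set U -> coarse U -> far_refinable M U x0) ->
  forall U, coarse U -> far_refinable M U x0.
Proof.
move=> refK farfin U /refK[V [VU /(coarseP x0) cV VK]] s.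
have /choice[rho rhoP] (m : nat) := cV (2 * K.+1 * m)%:R.
(* At levels [m > 0], balls of radius [2 (K + 1) m], the largest depth required
   of a deep member, lie in members of [V]. *)
have [lev levP] := exists_level_function x0 rho.
have deep_ex x (i : nat) : (0 < lev x)%N -> (i < K.+1)%N ->
    deep_members V lev i.+1 x !=set0.
  move=> lx iK; have /rhoP : rho (lev x) <= mdist x x0.
    by apply: (level_far levP); rewrite lx leqnn.
  move=> /contains_ballT_nat[W VW Wx]; exists W; split=> // y xy; apply: Wx.
  by apply: lt_le_trans xy _; rewrite ler_nat; nia.
set s' := (Num.truncn s).+1.
have [r1 r1P] := farfin _ (finite_image _ (finite_II _))
  (coarse_gap_sets VK levP) s'%:R.
have [r2 r2P] := level_unbounded levP (2 * K.+1 + s').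
exists (Num.max r1 r2) => A bA Ar.
have {}r2P x : A x -> (2 * K.+1 + s' <= lev x)%N.
  by move=> /Ar; rewrite ge_max => /andP[_ /r2P].
have [|E [/refines_restrict Eg EM Eb]] := r1P A bA.
  by move=> x /Ar; rewrite ge_max => /andP[].
have /choice[ix ixP] (W : set X) : exists i, E W ->
    (i < K.+1)%N /\ W `<=` gap_set V lev i.+1.
  have [/Eg[_ [_ [i /= iK <-] Wi]]|] := pselect (E W); last by exists 0%N.
  by exists i.
(* A member [W] lies in a gap set; the classes of equal deep members cut it
   into pieces, each contained in any of its deep members. *)
pose piece W x := W `&`
  [set y | deep_members V lev (ix W).+1 y = deep_members V lev (ix W).+1 x].
exists [set F | exists W x, [/\ E W, W x & F = piece W x]]; split.
- apply/refines_restrict => _ [W [x [EW Wx ->]]].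
  have [WA _] := Eg _ EW; split; first by move=> y [/WA].
  have [iK Wgap] := ixP W EW.
  have [|W' [VW' W'x]] := deep_ex x _ _ iK; first by have := r2P _ (WA _ Wx); lia.
  have [W'' UW'' W'W''] := VU _ VW'; exists W'' => // y [Wy dyx].
  apply: W'W''; have [_ W'y] : deep_members V lev (ix W).+1 y W' by rewrite dyx.
  by apply: ball_in_center W'y; have := r2P _ (WA _ Wy); nia.
- move=> x; apply: (card_members_le (f := piece^~ x)) (EM x).
  move=> _ [[W [z [EW Wz ->]]] [Wx dxz]]; exists W => //.
  by rewrite /piece; congr (_ `&` _); apply/seteqP; split=> y /= ->.
- move=> x Ax; apply: (@contains_ball_le _ _ _ _ _ s'%:R).
    exact/ltW/truncnS_gt.
  have [W EW Wx] := Eb x Ax.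
  have Wxx : W x by apply: Wx => //; rewrite mdistxx ltr0n.
  have [iK Wgap] := ixP W EW.
  exists (piece W x); first by exists W, x.
  move=> y Ay xy; split; first exact: Wx.
  have lx := r2P _ Ax; have ly := r2P _ Ay.
  have [|lyx lxy] := @level_slow _ _ _ _ _ levP x y.
    by apply: lt_le_trans xy _; rewrite -natrM ler_nat; lia.
  apply/esym; apply: (deep_members_eq _ _ xy) => //; [| | lia | lia].
    exact: Wgap.
  by apply: Wgap; exact: Wx.
Qed.

End GapSets.

(** * Gluing refinements of annuli *)

Section Gluing.
Context {R : realType} {X : metricType R}.
Implicit Types (x y z : X) (A B D W : set X) (U V : set (set X)).

(** A refinement good for a scale is good for the smaller ones, so the largest
    feasible scale serves all; bounding the scales by [n] makes sure that there
    is a largest one.  This is how refinements on a sequence of sets given in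
    advance acquire Lebesgue numbers tending to infinity. *)
Lemma best_refinement (M n : nat) U A : exists V,
  [/\ refines V (restrict_family U A), mult_le M V
    & forall j, (j <= n)%N -> refinable_on M U A j%:R ->
        forall x, A x -> contains_ball A V j%:R x].
Proof.
elim: n => [|n [V [VU VM Vb]]].
  have [[V [VU VM Vb]]|n0] := pselect (refinable_on M U A 0%:R).
    by exists V; split=> // j; rewrite leqn0 => /eqP -> _.
  exists set0; split=> //; first exact: mult_le_set0.
  by move=> j; rewrite leqn0 => /eqP ->.
have [[V' [V'U V'M V'b]]|nn] := pselect (refinable_on M U A n.+1%:R).
  exists V'; split=> // j jn _ x Ax; apply: contains_ball_le (V'b x Ax).
  by rewrite ler_nat.
exists V; split=> // j; rewrite leq_eqVlt => /orP[/eqP ->//|]; exact: Vb.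
Qed.

Definition small_members (lev : X -> nat) U : set (set X) :=
  [set B | (exists2 W, U W & B `<=` W) /\
     forall x y, B x -> B y -> mdist x y <= (lev x)%:R].

Lemma coarse_small_members (x0 : X) rho lev U :
  level_function x0 rho lev -> coarse U -> coarse (small_members lev U).
Proof.
move=> levP /(coarseP x0) cU; apply/(coarseP x0) => s.
set s' := (Num.truncn s).+1.
have [r1 r1P] := cU s'%:R; have [r2 r2P] := level_unbounded levP (2 * s').+1.
exists (Num.max r1 r2) => x; rewrite ge_max => /andP[/r1P[W UW Wx] /r2P lx].
apply: (@contains_ball_le _ _ _ _ _ s'%:R); first exact/ltW/truncnS_gt.
exists [set y | mdist x y < s'%:R]; last by [].
split; first by exists W => // y; exact: Wx.
move=> y z /= xy xz; have [|_ lxy] := @level_slow _ _ _ _ _ levP x y.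
  by apply: lt_le_trans xy _; rewrite -natrM ler_nat; lia.
apply: (@le_trans _ _ (2 * s')%:R); last by rewrite ler_nat; lia.
have := metric_triangle y x z; rewrite (metric_sym y x) natrM; lra.
Qed.

Definition even_levels (lev : X -> nat) : set X := [set x | ~~ odd (lev x)].

(** The neighbourhood of [B] whose even part the absorbing set must contain;
    its radius, the level, exceeds any fixed scale far out. *)
Definition near_region (lev : X -> nat) B : set X :=
  [set y | exists2 z, B z & mdist z y < (lev z)%:R].

(** The default value [B] makes [B] its own absorber, and thereby a member of
    the glued family, when no member of [E] is large enough. *)
Definition absorber (lev : X -> nat) (E : set (set X)) B : set X :=
  xget B [set D | E D /\ B `|` (near_region lev B `&` even_levels lev) `<=` D].

(** Every member of [V] is contained in its absorber, so gluing never enlarges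
    [D] and the glued family is a refinement. *)
Definition glued (lev : X -> nat) (E V : set (set X)) D : set X :=
  (D `&` even_levels lev) `|` \bigcup_(B in V `&` [set B | absorber lev E B = D]) B.

Lemma sub_absorber lev E B : B `<=` absorber lev E B.
Proof.
rewrite /absorber; case: xgetP => [D _ [_ BD]|_] x Bx //.
by apply: BD; left.
Qed.

Lemma glued_sub lev E V D : glued lev E V D `<=` D.
Proof. by move=> x [[]//|[B [_ <-] Bx]]; exact: sub_absorber. Qed.

(** Gluing the refinements chosen around the even levels and on the odd levels.
    Even levels are disjoint from the members chosen on odd levels, and each of
    the latter enters one glued set only; hence at any point the multiplicity
    is that of one of the original refinements. *)
Lemma far_refinable_glue (x0 : X) (M : nat) :
  (forall U, coarse U -> far_refinable M U x0) ->
  forall U, coarse U -> exists V, [/\ refines V U, coarse V & mult_le M V].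
Proof.
move=> far U cU.
have /choice[rho rhoP] (m : nat) := far U cU (3 * m.+2)%:R.
have [lev levP] := exists_level_function x0 (fun m => Num.max (rho m) m%:R).
have lev_ge x m : (0 < m <= lev x)%N -> m%:R <= mdist x x0.
  by move=> /(level_far levP); rewrite ge_max => /andP[].
(* The refinement of index [i] lives on the levels [i - 1], [i], [i + 1], and
   for even [i] only its trace on level [i] is kept.  It contains balls of
   radius [3 (i + 1)]: enough for a set of diameter at most [i + 1] on an
   adjacent level together with its neighbourhood of the same radius. *)
pose wide i := [set x | ((lev x).+1 >= i)%N && (lev x <= i.+1)%N].
pose thin m := [set x | lev x = m].
have wide_bounded i : bounded (wide i).
  have [r rP] := level_bounded levP i.+1.
  by exists r => x y /andP[_ xi] /andP[_ yi]; exact: rP.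
have thin_bounded i : bounded (thin i).
  have [r rP] := level_bounded levP i.
  by exists r => x y xi yi; apply: rP => /=; rewrite ?xi ?yi.
have /choice[E EP] i : exists E, [/\ refines E (restrict_family U (wide i)),
    mult_le M E & (1 < i)%N -> forall x, wide i x ->
      contains_ball (wide i) E (3 * i.+1)%:R x].
  case: i => [|[|i]]; [exists set0|exists set0|]; try split=> //;
    try exact: mult_le_set0.
  have [|E [EU EM Eb]] := rhoP i.+1 (wide i.+2) (wide_bounded _).
    move=> x /andP[ix _]; have := @level_far _ _ _ _ _ levP i.+1 x.
    by rewrite ge_max => /(_ ix)/andP[].
  by exists E.
(* On level [m], members of a refinement of [D'] have diameter at most [m]. *)
set D' := small_members lev U.
have cD' : coarse D' by exact: coarse_small_members levP cU.
have /choice[T TP] m := best_refinement M m D' (thin m).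
have Tball (s : nat) : exists m0, forall m, (m0 <= m)%N -> forall x, thin m x ->
    contains_ball (thin m) (T m) s%:R x.
  have [r rP] := far D' cD' s%:R.
  exists (maxn s (Num.truncn r).+1) => m; rewrite geq_max => /andP[sm rm].
  have [_ _] := TP m; apply=> //; apply: rP => // x xm.
  apply/ltW/(lt_le_trans (truncnS_gt r)); apply: (@le_trans _ _ m%:R).
    by rewrite ler_nat.
  by apply: lev_ge; rewrite xm leqnn andbT (leq_trans _ rm).
have Twide i D : E i D -> D `<=` wide i.
  by have [/refines_restrict EU _ _] := EP i => /EU[].
have Tthin m B : T m B -> B `<=` thin m.
  by have [/refines_restrict TU _ _] := TP m => /TU[].
pose EE := \bigcup_(i in [set i | ~~ odd i]) E i.
pose TT := \bigcup_(m in [set m | odd m]) T m.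
set Y := even_levels lev; set p := absorber lev EE; set G := glued lev EE TT.
have TTY B x : TT B -> B x -> odd (lev x) /\ T (lev x) B.
  by move=> [m /= om TB] Bx; have /= -> := Tthin _ _ TB _ Bx.
have EEY D x : EE D -> D x -> Y x -> E (lev x) D.
  move=> [i /= ei ED] Dx Yx; suff <- : i = lev x by [].
  have /andP[] := Twide _ _ ED _ Dx; move: ei Yx; rewrite /Y /even_levels /=; lia.
have GM : mult_le M (G @` (EE `|` TT)).
  move=> x; have [Yx|ox] := boolP (~~ odd (lev x)).
    have [_ EM _] := EP (lev x).
    apply: (card_members_le (f := G)) (EM x) => _ [[D ED <-]] Gx.
    exists D => //; have Dx := glued_sub Gx.
    case: ED => [ED|/TTY/(_ Dx)[]]; last by rewrite (negbTE Yx).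
    by split=> //; exact: EEY.
  have [_ TM _] := TP (lev x).
  apply: (card_members_le (f := G \o p)) (TM x) => _ [[D ED <-]].
  move=> [[_]|[B [TB pB] Bx]]; first by rewrite /even_levels /= (negbTE ox).
  by exists B; [split=> //; have [] := TTY _ _ TB Bx|rewrite -pB].
exists (G @` (EE `|` TT)); split=> //.
  move=> _ [D ED <-]; suff [W UW DW] : exists2 W, U W & D `<=` W.
    by exists W => //; apply: subset_trans DW; exact: glued_sub.
  case: ED => [[i _ /=]|[m _ /=]].
    by have [/refines_restrict EU _ _] := EP i => /EU[].
  have [/refines_restrict TU _ _] := TP m => /TU[_ [B [[W UW BW] _] DB]].
  by exists W => //; exact: subset_trans BW.
apply/(coarseP x0) => s; set s' := (Num.truncn s).+1.
have [m0 m0P] := Tball (4 * s')%N.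
have [r rP] := level_unbounded levP (m0 + 2 * s' + 10).
exists r => x /rP lx; apply: (@contains_ball_le _ _ _ _ _ s'%:R).
  exact/ltW/truncnS_gt.
have near_lev y z (k : nat) : mdist y z < k%:R -> (k <= 4 * (lev y).+1)%N ->
    (lev z <= (lev y).+1)%N /\ (lev y <= (lev z).+1)%N.
  move=> yz kl; apply: (level_slow levP); apply: lt_le_trans yz _.
  by rewrite -natrM ler_nat.
(* A ball inside the even levels lies in a member chosen there; a ball meeting
   an odd level at [z] lies in the glued set of the absorber of a member
   containing a larger ball around [z]. *)
have [xY|/existsNP[z /not_implyP[xz /negP/negPn oz]]] :=
    pselect (forall y, mdist x y < s'%:R -> Y y).
  have Yx : Y x by apply: xY; rewrite mdistxx ltr0n.
  have [_ _ Eb] := EP (lev x).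
  have [||D ED Dx] := Eb _ x; [by lia|by rewrite /wide /=; lia|].
  exists (G D); first by exists D => //; left; exists (lev x).
  move=> y _ xy; left; split; last exact: xY.
  apply: Dx; last by apply: lt_le_trans xy _; rewrite ler_nat; lia.
  by have [|? ?] := near_lev x y s' xy; [lia|rewrite /wide /=; lia].
have [|lzx lxz] := near_lev x z s' xz; first by lia.
have [|B TB Bz] := m0P (lev z) _ z erefl; first by lia.
have TTB : TT B by exists (lev z).
exists (G (p B)).
  exists (p B) => //; rewrite /p /absorber.
  by case: xgetP => [D _ [ED _]|_]; [left|right].
move=> y _ xy; have zy : mdist z y < (2 * s')%:R.
  by have := metric_triangle z x y; rewrite (metric_sym z x) natrM; lra.
have [|lyz lzy] := near_lev z y _ zy; first by lia.
have [Yy|/negP/negPn oy] := boolP (~~ odd (lev y)); last first.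
  right; exists B => //; apply: Bz; first by rewrite /thin /=; lia.
  by apply: lt_le_trans zy _; rewrite ler_nat; lia.
left; split=> //.
have Bzz : B z by apply: Bz => //; rewrite mdistxx ltr0n; lia.
have Bdiam w : B w -> mdist z w <= (lev z)%:R.
  have [/refines_restrict TU _ _] := TP (lev z).
  by have [_ [B' [_ B'd] BB']] := TU _ TB => Bw; apply: B'd; exact: BB'.
(* If the ball also meets an even level at [y], then the member containing the
   ball of radius [3 (lev y + 1)] around [z] can absorb [B]. *)
have [D [EED BD]] : exists D, EE D /\ B `|` (near_region lev B `&` Y) `<=` D.
  have [_ _ Eb] := EP (lev y).
  have [||D ED Dz] := Eb _ z; [by lia|by rewrite /wide /=; lia|].
  exists D; split; first by exists (lev y).
  move=> w [Bw|[[v Bv vw] Yw]].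
    apply: Dz; first by have /= := Tthin _ _ TB _ Bw; rewrite /wide /thin /=; lia.
    by apply: le_lt_trans (Bdiam _ Bw) _; rewrite ltr_nat; lia.
  have lv : lev v = lev z by exact: Tthin Bv.
  have zw : mdist z w < (2 * lev z)%:R.
    have := metric_triangle z v w; have := Bdiam _ Bv.
    by move: vw; rewrite lv natrM; lra.
  apply: Dz; last by apply: lt_le_trans zw _; rewrite ler_nat; lia.
  have yw : mdist y w < (2 * s' + 2 * lev z)%:R.
    have := metric_triangle y z w; rewrite (metric_sym y z) natrD; lra.
  by have [|? ?] := near_lev y w _ yw; [lia|rewrite /wide /=; lia].
have [_ pBD] : [set D | EE D /\ B `|` (near_region lev B `&` Y) `<=` D] (p B).
  by apply: xgetPex; exists D.
apply: pBD; right; split=> //; exists z => //.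
by apply: lt_le_trans zy _; rewrite ler_nat; lia.
Qed.

End Gluing.

(** * Equality of the dimensions *)

Section Equality.
Context {R : realType} {X : metricType R}.
Implicit Types (x y z : X) (A B D W : set X) (U V : set (set X)).

Lemma coarse_refinement_far (x0 : X) (M : nat) U V :
  refines V U -> coarse V -> mult_le M V -> far_refinable M U x0.
Proof.
move=> VU /(coarseP x0) cV VM s; have [r rP] := cV s; exists r => A _ Ar.
exists (restrict_family V A); split.
- apply/refines_restrict => _ [W VW <-]; split; first by move=> y [].
  by have [W' UW' WW'] := VU _ VW; exists W' => // y [/WW'].
- move=> x; apply: (card_members_le (f := fun W => W `&` A)) (VM x).
  by move=> _ [[W VW <-] [Wx _]]; exists W.
- move=> x Ax; have [W VW Wx] := rP x (Ar x Ax).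
  exists (W `&` A); first by exists W.
  by move=> y Ay xy; split=> //; exact: Wx.
Qed.

Definition major_bound (n : int) : Prop := forall U, coarse U ->
  exists V, [/\ refines V U, coarse V & (multiplicity V <= ((n + 1)%:~R)%:E)%E].

Definition large_scale_bound (n : int) : Prop := forall U, finite_set U ->
  coarse U -> coarsely_proper_on_bounded (Ln n U).

Lemma major_boundP (M : nat) (n : int) : n + 1 = M%:Z ->
  major_bound n <->
  forall U, coarse U -> exists V, [/\ refines V U, coarse V & mult_le M V].
Proof.
move=> nM; have nME : ((n + 1)%:~R)%:E = M%:R%:E :> \bar R by rewrite nM.
rewrite /major_bound nME; split=> PU U /PU[V [VU cV /multiplicityP VM]];
  by exists V.
Qed.

(** [N] provides a finite multiplicity for coarse refinements, however large
    compared with [n]; the sharp value [n + 1] comes out of the gluing. *)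
Lemma major_large_scale_bound (x0 : X) (n N : int) :
  -1 <= n -> -1 <= N -> major_bound N ->
  major_bound n <-> large_scale_bound n.
Proof.
move=> n1 N1 mN; have [M nM] : exists M : nat, n + 1 = M%:Z.
  by exists `|(n + 1)%R|%N; lia.
have [K NK] : exists K : nat, N + 1 = K%:Z by exists `|(N + 1)%R|%N; lia.
split=> [/(major_boundP nM) mn U _ /mn[V [VU cV VM]]|ls].
  by apply/(Ln_properP x0 _ nM); exact: coarse_refinement_far VU cV VM.
apply/(major_boundP nM); apply: (far_refinable_glue (x0 := x0)).
apply: (coarse_far_refinable (K := K)); first exact/(major_boundP NK).
by move=> U fU cU; apply/(Ln_properP x0 _ nM); exact: ls.
Qed.

End Equality.

Lemma smallest_dim_fin_num (P : int -> Prop) :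
  smallest_dim P \is a fin_num -> exists2 n : int, -1 <= n & P n.
Proof.
by rewrite /smallest_dim; case: xgetP => // d _ [n [_ n1 Pn _]] _; exists n.
Qed.

Lemma eq_smallest_dim (P Q : int -> Prop) :
  (forall n : int, -1 <= n -> P n <-> Q n) -> smallest_dim P = smallest_dim Q.
Proof.
move=> PQ; congr (xget _ _); apply/seteqP; split=> d [n [-> n1 Pn nmin]];
  by exists n; split=> // [|m m1 Pm]; [|apply: nmin => //]; apply/PQ.
Qed.

Local Open Scope ereal_scope.

Theorem corollary6p8 (R : realType) (X : metricType R) :
  major_coarse_dim X \is a fin_num ->
  major_coarse_dim X = large_scale_dim X.
Proof.
move=> /smallest_dim_fin_num[N N1 mN]; apply: eq_smallest_dim => n n1.
have [[x0 _]|X0] := pselect (exists x : X, True).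
  exact: major_large_scale_bound n1 N1 mN.
(* In the empty space nothing tends to infinity, so both bounds hold. *)
split=> [_ U _ _ A /(_ 0%N)[[x]]|_ U _]; first by case: X0; exists x.
exists set0; split=> [W []|u [x]|]; first by case: X0; exists x.
have [M nM] : exists M : nat, (n + 1 = M%:Z)%R by exists `|(n + 1)%R|%N; lia.
rewrite nM; apply/multiplicityP; exact: mult_le_set0.
Qed.
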